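(* Let $Q$ be the quiver with vertices $1,2,3,4$ and single arrows $1\to2$, $1\to3$, $1\to4$, $2\to4$, $4\to3$, $3\to2$. Then $Q$ does not have any admissible quasi-Cartan companion, and hence $Q$ is not mutation-acyclic.
   Context: A quiver is a finite directed multigraph with no loops and no oriented 2-cycles; for a quiver on vertices $1,\dots,n$, $B=(b_{ij})$ is the skew-symmetric matrix with $b_{ij}$ equal to the number of arrows $i\to j$ minus the number of arrows $j\to i$. A quasi-Cartan companion of $Q$ is a symmetric integer matrix $A=(a_{ij})$ with $a_{ii}=2$ and $|a_{ij}|=|b_{ij}|$ for $i\ne j$. A cycle in $Q$ is an induced subquiver whose vertices can be labelled by $\mathbb{Z}/k\mathbb{Z}$ so that the only pairs of adjacent vertices are $\{i,i+1\}$, $i\in\mathbb{Z}/k\mathbb{Z}$. $A$ is admissible if for every cycle $Z$ of $Q$: if $Z$ is an oriented cycle, the number of edges $\{i,j\}$ of $Z$ with $a_{ij}>0$ is odd, and if $Z$ is non-oriented, this number is even. Mutation $\mu_k$: for every path $i\to k\to j$ add an arrow $i\to j$, reverse all arrows at $k$, delete a maximal collection of oriented 2-cycles. $Q$ is mutation-acyclic if some quiver obtained from $Q$ by a sequence of mutations has no oriented cycles. *)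

(* Defs.v *)
From HB Require Import structures.
From mathcomp Require Import all_boot all_order all_algebra.

Set Implicit Arguments.
Unset Strict Implicit.
Unset Printing Implicit Defensive.

Import Order.TTheory GRing.Theory Num.Theory.
Local Open Scope ring_scope.

(* [arrows Q i j] is the number of arrows i -> j; the vertices 1, ..., n are
   represented by the ordinals 0, ..., n - 1. *)
Record quiver (n : nat) := Quiver {
  arrows :> 'M[nat]_n;
  no_loop : forall i, arrows i i = 0%N;
  no_2cycle : forall i j, arrows i j = 0%N \/ arrows j i = 0%N
}.

Definition exchange_matrix n (Q : quiver n) : 'M[int]_n :=
  \matrix_(i, j) ((Q i j)%:Z - (Q j i)%:Z).

Definition adjacent n (Q : quiver n) (i j : 'I_n) : bool :=
  (0 < Q i j)%N || (0 < Q j i)%N.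

Definition quasi_cartan_companion n (Q : quiver n) (A : 'M[int]_n) : Prop :=
  [/\ A^T = A,
      forall i, A i i = 2
    & forall i j, i != j -> `|A i j| = `|exchange_matrix Q i j|].

(* 'I_k with [ordS] (cyclic successor) plays the role of Z/kZ. An induced
   subquiver is given by its vertex set Z. Cycles have length at least 3: for
   k = 2 every single edge would be a cycle. *)
Definition cycle_labelling n (Q : quiver n) (Z : {set 'I_n}) (k : nat)
    (c : 'I_k -> 'I_n) : Prop :=
  [/\ (2 < k)%N, injective c, c @: [set: 'I_k] = Z
    & forall a b, adjacent Q (c a) (c b) = (b == ordS a) || (a == ordS b)].

Definition is_cycle n (Q : quiver n) (Z : {set 'I_n}) : Prop :=
  exists (k : nat) (c : 'I_k -> 'I_n), cycle_labelling Q Z c.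

Definition is_oriented_cycle n (Q : quiver n) (Z : {set 'I_n}) : Prop :=
  exists (k : nat) (c : 'I_k -> 'I_n),
    cycle_labelling Q Z c /\ forall a, (0 < Q (c a) (c (ordS a)))%N.

(* Each unordered edge {i, j} is represented once, by the pair with i < j. *)
Definition positive_edges n (Q : quiver n) (A : 'M[int]_n) (Z : {set 'I_n}) :
    {set 'I_n * 'I_n} :=
  [set e | [&& e.1 \in Z, e.2 \in Z, (e.1 < e.2)%N,
               adjacent Q e.1 e.2 & 0 < A e.1 e.2]].

Definition admissible n (Q : quiver n) (A : 'M[int]_n) : Prop :=
  forall Z : {set 'I_n}, is_cycle Q Z ->
    (is_oriented_cycle Q Z -> odd #|positive_edges Q A Z|) /\
    (~ is_oriented_cycle Q Z -> ~~ odd #|positive_edges Q A Z|).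

Definition add_paths n (k : 'I_n) (M : 'M[nat]_n) : 'M[nat]_n :=
  \matrix_(i, j) (M i j + M i k * M k j)%N.

Definition reverse_at n (k : 'I_n) (M : 'M[nat]_n) : 'M[nat]_n :=
  \matrix_(i, j) (if (i == k) || (j == k) then M j i else M i j).

(* A maximal collection of 2-cycles between i and j uses [minn (M i j) (M j i)]
   arrows in each direction. *)
Definition delete_2cycles n (M : 'M[nat]_n) : 'M[nat]_n :=
  \matrix_(i, j) (M i j - minn (M i j) (M j i))%N.

Definition mutate_arrows n (k : 'I_n) (M : 'M[nat]_n) : 'M[nat]_n :=
  delete_2cycles (reverse_at k (add_paths k M)).

Lemma mutate_no_loop n (k : 'I_n) (M : 'M[nat]_n) (i : 'I_n) :
  mutate_arrows k M i i = 0%N.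
Proof. by rewrite mxE minnn subnn. Qed.

Lemma mutate_no_2cycle n (k : 'I_n) (M : 'M[nat]_n) (i j : 'I_n) :
  mutate_arrows k M i j = 0%N \/ mutate_arrows k M j i = 0%N.
Proof.
rewrite [X in X = _ \/ _]mxE [X in _ \/ X = _]mxE.
set a := reverse_at _ _ i j; set b := reverse_at _ _ j i.
case/orP: (leq_total a b) => h; [left|right].
  by rewrite (minn_idPl h) subnn.
by rewrite (minn_idPl h) subnn.
Qed.

Definition mutate n (Q : quiver n) (k : 'I_n) : quiver n :=
  Quiver (mutate_no_loop k Q) (mutate_no_2cycle k Q).

Definition acyclic n (Q : quiver n) : Prop :=
  forall Z : {set 'I_n}, ~ is_oriented_cycle Q Z.

Definition mutation_acyclic n (Q : quiver n) : Prop :=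
  exists ks : seq 'I_n, acyclic (foldl (@mutate n) Q ks).

Definition vortex_arrows : 'M[nat]_4 :=
  \matrix_(i < 4, j < 4) count_mem (i.+1, j.+1)
    [:: (1, 2); (1, 3); (1, 4); (2, 4); (4, 3); (3, 2)]%N.

Lemma vortex_no_loop (i : 'I_4) : vortex_arrows i i = 0%N.
Proof. by rewrite mxE; case: i => [[|[|[|[|i]]]] Hi]. Qed.

Lemma vortex_no_2cycle (i j : 'I_4) :
  vortex_arrows i j = 0%N \/ vortex_arrows j i = 0%N.
Proof.
rewrite !mxE; case: i j => [[|[|[|[|i]]]] Hi] [[|[|[|[|j]]]] Hj] //.
all: solve [by left | by right].
Qed.

Definition vortex : quiver 4 := Quiver vortex_no_loop vortex_no_2cycle.

(* [acyclic] only mentions induced oriented cycles; this agrees with the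
   absence of closed directed walks. *)
Lemma acyclicP n (Q : quiver n) :
  acyclic Q <->
  forall s : seq 'I_n, s != [::] -> ~~ cycle (fun i j => (0 < Q i j)%N) s.
Proof.
set e := fun i j : 'I_n => (0 < Q i j)%N.
have e2 i j : e i j -> e j i -> False.
  by rewrite /e; case: (no_2cycle Q i j) => ->.
have nthS (x0 : 'I_n) s : cycle e s <->
    forall i, (i < size s)%N -> e (nth x0 s i) (nth x0 s (i.+1 %% size s)).
  case: s => [|x s] //=.
  split=> [/(pathP x0)|] H.
    move=> i lti; have := H i; rewrite size_rcons => /(_ lti).
    rewrite -rcons_cons !nth_rcons /= lti.
    move: lti; rewrite ltnS leq_eqVlt => /orP[/eqP->|lti].
      by rewrite ltnn eqxx modnn.
    by rewrite lti modn_small.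
  apply/(pathP x0) => i; rewrite size_rcons => lti.
  have := H i lti.
  rewrite -rcons_cons !nth_rcons /= lti.
  move: lti; rewrite ltnS leq_eqVlt => /orP[/eqP->|lti].
    by rewrite ltnn eqxx modnn.
  by rewrite lti modn_small.
split=> [acQ|H Z [k [c [[k2 _ _ _] ec]]]]; last first.
  have k0 : (0 < k)%N by apply: leq_trans k2.
  set s := [seq c a | a <- enum 'I_k].
  have ss : size s = k by rewrite size_map size_enum_ord.
  have s0 : s != [::] by rewrite -size_eq0 ss -lt0n.
  have := H s s0; case/negP; apply/(nthS (c (Ordinal k0))) => i; rewrite ss => ik.
  have nthc (j : 'I_k) : nth (c (Ordinal k0)) s j = c j.
    by rewrite (nth_map j) ?size_enum_ord // nth_ord_enum.
  have -> : nth (c (Ordinal k0)) s i = c (Ordinal ik) by exact: (nthc (Ordinal ik)).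
  have -> : nth (c (Ordinal k0)) s (i.+1 %% k) = c (ordS (Ordinal ik)).
    exact: (nthc (ordS (Ordinal ik))).
  exact: ec.
(* a shortest closed directed walk is an induced oriented cycle *)
move=> s; have [m] := ubnP (size s); elim: m s => // m IH s szs s0.
apply/negP => cs.
have {}IH t : (0 < size t)%N -> (size t < size s)%N -> cycle e t -> False.
  move=> t0 ts; apply/negP; apply: IH; first exact: leq_trans ts _.
  by rewrite -size_eq0 -lt0n.
set k := size s.
have k0 : (0 < k)%N by rewrite lt0n size_eq0.
have [x0 _] : exists x0 : 'I_n, x0 \in s.
  by case: (s) s0 => [|x s'] // _; exists x; rewrite mem_head.
have key x t : cycle e (x :: t) -> size (x :: t) = k ->
    x \notin t /\
    forall i, (i < size t)%N -> e x (nth x0 t i) -> i = 0%N.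
  move=> /= cx sz; split.
  - apply/negP => xt; case/splitPr: xt cx sz => t1 t2.
    rewrite rcons_cat cat_path /= size_cat /= => /and3P[p1 ex _] sz.
    by apply: (IH (x :: t1)) => /=;
      rewrite ?rcons_path ?p1 // -/k -sz ltnS addnS ltnS leq_addr.
  - move=> i it exi; apply/eqP; rewrite -leqn0 leqNgt; apply/negP => i0.
    apply: (IH (x :: drop i t)) => //=.
      by rewrite -/k -sz /= ltnS size_drop ltn_subrL i0 (leq_trans _ it).
    rewrite (drop_nth x0) //= exi /=.
    move: cx; rewrite -{1}(cat_take_drop i t) rcons_cat cat_path => /andP[_].
    by rewrite (drop_nth x0) //= => /andP[].
have rk (a : 'I_k) : exists t, [/\ rot a s = nth x0 s a :: t,
    cycle e (nth x0 s a :: t) & size (nth x0 s a :: t) = k].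
  exists (drop a.+1 s ++ take a s).
  have E : rot a s = nth x0 s a :: (drop a.+1 s ++ take a s).
    by rewrite /rot (drop_nth x0).
  by rewrite -E size_rot rot_cycle.
have nrot (a b : 'I_k) : exists2 i, (i < k)%N &
   nth x0 (rot a s) i = nth x0 s b /\ (a + i = b %[mod k])%N.
  exists ((b + (k - a)) %% k)%N; first by rewrite ltn_mod.
  have ak := ltn_ord a; have bk := ltn_ord b.
  have sd : size (drop a s) = (k - a)%N by rewrite size_drop.
  rewrite modnDmr addnCA subnKC ?(ltnW ak) // modnDr; split=> //.
  rewrite /rot nth_cat sd; have [ab|ba] := leqP a b.
    have E : (b + (k - a) = b - a + k)%N.
      by rewrite addnBA ?(ltnW ak) // addnBAC.
    rewrite E modnDr (modn_small (leq_ltn_trans (leq_subr a b) bk)).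
    by rewrite ltn_sub2r ?(leq_ltn_trans ab) // nth_drop subnKC.
  rewrite modn_small; last first.
    by rewrite -[X in (_ < X)%N](subnKC (ltnW ak)) ltn_add2r.
  by rewrite ltnNge leq_addl /= addnK nth_take.
pose c (a : 'I_k) := nth x0 s a.
have ec a : e (c a) (c (ordS a)).
  by have /(nthS x0) := cs; apply; apply: ltn_ord.
have ordSE (a b : 'I_k) : (a + 1 = b %[mod k])%N -> b = ordS a.
  move=> h; apply: val_inj => /=; rewrite -addn1 h modn_small //.
have far (a b : 'I_k) : e (c a) (c b) -> b = ordS a.
  move=> eab; have [t [E ct st]] := rk a; have [_ K] := key _ _ ct st.
  have [[|i] ik []] := nrot a b; rewrite E /= => ni ai.
    by move: eab; rewrite /c ni /e no_loop.
  apply: ordSE; rewrite -ai; congr (_ %% _)%N; congr (_ + _.+1)%N.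
  by symmetry; apply: K; [rewrite -ltnS [(size t).+1]st | rewrite ni].
have k2 : (2 < k)%N.
  rewrite ltnNge; apply/negP => k2.
  have kE (a : 'I_k) : ordS (ordS a) = a.
    apply: val_inj => /=; rewrite -addn1 modnDml addn1.
    have := ltn_ord a; move: (nat_of_ord a) => i.
    have [->|->] : k = 1%N \/ k = 2%N.
    - by case: (k) k0 k2 => [|[|[|?]]] //; [left | right].
    - by case: i.
    - by case: i => [|[|]].
  have a := Ordinal k0.
  by apply: (e2 (c a) (c (ordS a))) => //; rewrite -[X in e _ (c X)]kE.
apply: (acQ (c @: [set: 'I_k])); exists k, c; split=> //; split=> //.
  move=> a b cab; have [t [E ct st]] := rk a; have [xt _] := key _ _ ct st.
  have [[|i] ik []] := nrot a b; rewrite E /= => ni.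
    by rewrite addn0 !modn_small // => /val_inj.
  case/negP: xt; rewrite -[X in X \in _]/(c a) cab /c -ni mem_nth //.
  by rewrite -ltnS [(size t).+1]st.
move=> a b; apply/orP/orP => -[].
- by move/far => ->; left.
- by move/far => ->; right.
- by move/eqP => ->; left; apply: ec.
- by move/eqP => ->; right; apply: ec.
Qed.

(* Main.v *)
(** In the vortex any two vertices are adjacent, so its cycles are the four
    triangles, and only the one avoiding the source is oriented.  Every edge lies
    in exactly two triangles, hence the numbers of positive edges in the four
    triangles add up to an even number, whereas an admissible companion would
    make this sum odd.

    For the second assertion one exhibits a set [reach] of quivers which contains
    the vortex, is closed under mutation, and whose members all contain an
    oriented triangle.  Far away from the vortex its members are "preforks": a
    vertex r, the point of return, has neighbours i -> r -> j and i -> r -> q (up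
    to reversing all arrows), with at least two arrows each, and there are at
    least as many arrows j -> i as arrows i -> r or r -> j, and similarly for q.
    A mutation at a vertex x <> r yields a prefork with point of return x, with one
    exception: if j and q are joined by at most one arrow, then the mutations at
    j and q generate a square or a pentagon, and one leaves it at a prefork by i
    or r.  Close to the vortex there are nine sporadic quivers, two sequences of
    quivers, and "strips": infinite chains of squares or pentagons glued along
    edges, generated by the mutations at three vertices of which two pairs are
    joined by at most one arrow. *)

From Stdlib Require Import ZArith Lia.
Require Import Defs.
From mathcomp Require Import all_boot all_order all_algebra.

Set Implicit Arguments.
Unset Strict Implicit.
Unset Printing Implicit Defensive.

(** * Mutation, relabelling and reversal of skew-symmetric 4 by 4 matrices *)

Local Open Scope Z_scope.

Arguments Z.mul : simpl never.
Arguments Z.add : simpl never.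
Arguments Z.sub : simpl never.

(* [bij] is the number of arrows i -> j minus the number of arrows j -> i. *)
Record skew4 := Skew4 { b01 : Z; b02 : Z; b03 : Z; b12 : Z; b13 : Z; b23 : Z }.

Definition pos (x : Z) : Z := Z.max x 0.

(* The new entry (i, j) after mutation at k, from the entries [x] at (i, k), [y] at
   (k, j) and [z] at (i, j). *)
Definition upd (x y z : Z) : Z := z + pos x * pos y - pos (- x) * pos (- y).

Definition mut (k : nat) (t : skew4) : skew4 :=
  let: Skew4 a b c d e f := t in
  match k with
  | 0%N =>
      Skew4 (- a) (- b) (- c) (upd (- a) b d) (upd (- a) c e) (upd (- b) c f)
  | 1%N => Skew4 (- a) (upd a d b) (upd a e c) (- d) (- e) (upd (- d) e f)
  | 2%N => Skew4 (upd b (- d) a) (- b) (upd b f c) (- d) (upd d f e) (- f)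
  | _ => Skew4 (upd c (- e) a) (upd c (- f) b) (- c) (upd e (- f) d) (- e) (- f)
  end.

(** Adjacent transpositions generate all relabellings of the vertices; [Opp] reverses all arrows. *)
Inductive gen := Sw01 | Sw12 | Sw23 | Opp.

Definition act (g : gen) (t : skew4) : skew4 :=
  let: Skew4 a b c d e f := t in
  match g with
  | Sw01 => Skew4 (- a) d e b c f
  | Sw12 => Skew4 b a c (- d) f e
  | Sw23 => Skew4 a c b e d (- f)
  | Opp => Skew4 (- a) (- b) (- c) (- d) (- e) (- f)
  end.

(* [vact g k] is the vertex of [t] that becomes the vertex [k] of [act g t]. *)
Definition vact (g : gen) (k : nat) : nat :=
  match g, k with
  | Sw01, 0%N => 1%N | Sw01, 1%N => 0%N
  | Sw12, 1%N => 2%N | Sw12, 2%N => 1%N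
  | Sw23, 2%N => 3%N | Sw23, _.+3 => 2%N
  | _, _ => k
  end.

Lemma updN x y z : upd (- x) (- y) (- z) = - upd x y z.
Proof. rewrite /upd !Z.opp_involutive; ring. Qed.

Lemma upd_sym x y z : upd y x z = upd x y z.
Proof. rewrite /upd; ring. Qed.

Lemma updK x y z x' y' : x' = - x -> y' = - y -> upd x' y' (upd x y z) = z.
Proof. by move=> -> ->; rewrite /upd !Z.opp_involutive; ring. Qed.

Lemma posE x : 0 <= x -> pos x = x.
Proof. exact: Z.max_l. Qed.

Lemma pos0 x : x <= 0 -> pos x = 0.
Proof. exact: Z.max_r. Qed.

Lemma updpp x y z : 0 <= x -> 0 <= y -> upd x y z = z + x * y.
Proof. by move=> hx hy; rewrite /upd (posE hx) (posE hy) (@pos0 (- x)); lia. Qed.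

Lemma updnn x y z : x <= 0 -> y <= 0 -> upd x y z = z - x * y.
Proof.
by move=> hx hy; rewrite /upd (pos0 hx) (@posE (- x)) ?(@posE (- y)); lia.
Qed.

Lemma updpn x y z : 0 <= x -> y <= 0 -> upd x y z = z.
Proof. by move=> hx hy; rewrite /upd (pos0 hy) (@pos0 (- x)); lia. Qed.

Lemma updnp x y z : x <= 0 -> 0 <= y -> upd x y z = z.
Proof. by move=> hx hy; rewrite upd_sym updpn. Qed.

Lemma mutK k : involutive (mut k).
Proof.
move=> [a b c d e f].
by case: k => [|[|[|k]]] /=; congr Skew4;
  rewrite ?Z.opp_involutive //; apply: updK; lia.
Qed.

Lemma actK g : involutive (act g).
Proof. by case: g => -[a b c d e f] /=; rewrite ?Z.opp_involutive. Qed.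

Lemma mut_act g k t : mut k (act g t) = act g (mut (vact g k) t).
Proof.
case: t => a b c d e f.
by case: g; case: k => [|[|[|k]]] /=; rewrite ?Z.opp_involutive;
  congr Skew4; rewrite ?Z.opp_involutive //;
  first [by rewrite upd_sym | by rewrite -updN ?Z.opp_involutive
        | by rewrite upd_sym -updN ?Z.opp_involutive].
Qed.

Definition actw (w : seq gen) (t : skew4) : skew4 := foldr act t w.

Definition vactw (w : seq gen) (k : nat) : nat :=
  foldl (fun j g => vact g j) k w.

Lemma mut_actw w k t : mut k (actw w t) = actw w (mut (vactw w k) t).
Proof. by elim: w k => //= g w IH k; rewrite mut_act IH. Qed.

Lemma actwK w t : actw (rev w) (actw w t) = t.
Proof.
elim: w t => //= g w IH t.
by rewrite /actw rev_cons foldr_rcons actK -/(actw (rev w) _) IH.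
Qed.

(** * The set of quivers to be closed under mutation *)

(* The point of return is the vertex 0, with arrows 1 -> 0 -> 2 and 1 -> 0 -> 3;
   the number of arrows between 2 and 3 is arbitrary. *)
Definition prefork (t : skew4) : Prop :=
  let: Skew4 a b c d e f := t in
  [/\ a <= - 2, 2 <= b, 2 <= c, d <= a /\ d <= - b & e <= a /\ e <= - c].

(* The strip is generated by the mutations at the vertices 0, 1, 2.  In Y there are
   [e] arrows (0 or 1) between 0 and 1, one between 1 and 2, and [n] between 0 and
   2.  The edge Y - Z (mutation at 1) is followed by the edge X - V, and this one by
   the next edge Y - Z.  Together with W, the edges Y - Z and X - V form a pentagon;
   X - V and the next Y - Z form a square if e = 0, and a pentagon with U if e = 1. *)
Definition nodeY e n A B C := Skew4 e n (- C) (- 1) B A.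
Definition nodeZ e n A B C := Skew4 (- e) n (e * B - C) 1 (- B) (A + B).
(** The entry at (0, 3) of X and V, which becomes the parameter [C] of the next Y. *)
Definition tail e n A B C := n * (A + B) + e * B - C.
Definition nodeX e n A B C :=
  Skew4 (- e) (- n) (tail e n A B C) (- 1) A (- (A + B)).
Definition nodeV e n A B C :=
  Skew4 e (- (n + e)) (tail e n A B C) 1 (- A) (- B).
Definition nodeW e n A B C := Skew4 (e + n) (- n) (n * A - C) 1 B (- A).
Definition nodeU n A B C :=
  let E := tail 1 n A B C in
  Skew4 (- 1) (n + 1) (- E) (- n) (- A) ((n + 1) * E - B).

(* The parameters are those of [nodeY]. *)
Inductive strip : Z -> Z -> Z -> Z -> Z -> Prop :=
| strip_family n : 2 <= n -> strip 1 n (n + 1) 1 2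
| strip_branch n : 2 <= n -> strip 1 (n + 1) (n * n + n - 2) (n + 1) n
| strip_start1 : strip 0 5 2 1 2
| strip_start2 : strip 0 5 7 1 2
| strip_start3 : strip 0 2 7 1 5
| strip_start4 : strip 1 7 9 2 2
| strip_start5 : strip 1 7 33 5 5
| strip_start6 : strip 1 2 8 5 5
| strip_next e n A B C : strip e n A B C ->
    let E := tail e n A B C in strip e n (n * E - A - B) (A + e * E) E.

Definition nodeP n := Skew4 (- (n + 1)) 1 1 (- n) (- 2) (- 1).
Definition nodeQ n := Skew4 (- (n + 1)) (- 1) 2 (- 2) (- n) (- 1).

(* The vortex comes first. *)
Definition sporadic : seq skew4 :=
  [:: Skew4 1 1 1 (- 1) 1 (- 1);
      Skew4 (- 2) (- 1) 1 0 (- 1) 1;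
      Skew4 (- 2) (- 1) 1 0 (- 1) (- 2);
      Skew4 (- 2) 0 1 (- 1) (- 1) 1;
      Skew4 (- 2) (- 1) 1 (- 1) 0 (- 2);
      Skew4 (- 2) (- 1) 1 1 (- 2) 1;
      Skew4 (- 3) 1 2 (- 2) (- 1) 0;
      Skew4 (- 2) (- 1) 1 (- 2) 1 (- 2);
      Skew4 (- 3) 1 1 (- 1) (- 1) (- 1)].

(* The inequalities say nothing about the mutation of a prefork at its point of
   return: this is why [reach_prefork] requires the result to be in the set. *)
Inductive reach : skew4 -> Prop :=
| reach_act g t : reach t -> reach (act g t)
| reach_sporadic t : List.In t sporadic -> reach t
| reach_P n : 2 <= n -> reach (nodeP n)
| reach_Q n : 2 <= n -> reach (nodeQ n)
| reach_Y e n A B C : strip e n A B C -> reach (nodeY e n A B C)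
| reach_Z e n A B C : strip e n A B C -> reach (nodeZ e n A B C)
| reach_X e n A B C : strip e n A B C -> reach (nodeX e n A B C)
| reach_V e n A B C : strip e n A B C -> reach (nodeV e n A B C)
| reach_W e n A B C : strip e n A B C -> reach (nodeW e n A B C)
| reach_U n A B C : strip 1 n A B C -> reach (nodeU n A B C)
| reach_prefork t : prefork t -> reach (mut 0 t) -> reach t
| reach_side t :
    prefork t -> - 1 <= b23 t <= 1 -> reach (mut 0 t) -> reach (mut 2 t)
| reach_bottom t :
    prefork t -> - 1 <= b23 t <= 1 -> reach (mut 0 t) -> reach (mut 3 (mut 2 t)).

(** * Membership criteria and inequalities for strips *)

Lemma reach_actw w t : reach t -> reach (actw w t).
Proof. by elim: w => //= g w IH ht; apply: reach_act; apply: IH. Qed.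

Lemma reach_iso w u t : reach u -> actw w u = t -> reach t.
Proof. by move=> hu <-; apply: reach_actw. Qed.

(** Mutation is an involution, so mutating the new prefork at its point of return leads back to [t];
    this supplies the second premise of [reach_prefork]. *)
Lemma reach_exit w k t : reach t -> vactw w 0 = k ->
  prefork (actw w (mut k t)) -> reach (mut k t).
Proof.
move=> ht <- st; rewrite -(actwK w (mut _ t)); apply: reach_actw.
by apply: reach_prefork => //; rewrite -mut_actw mutK; apply: reach_actw.
Qed.

Lemma strip_bounds e n A B C : strip e n A B C ->
  [/\ e = 0 \/ e = 1, 2 <= n, 2 <= A, 1 <= B <= A & 2 <= C <= A] /\
  (e = 1 -> C <= B + 1).
Proof.
elim=> {e n A B C} [n hn|n hn||||||| e n A B C _ [[he hn hA hB hC] hCB]].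
1-8: by split; [split | ]; nia.
have [hE hE1] : A + 2 * B <= tail e n A B C /\
    (e = 1 -> 2 * A + B <= tail e n A B C).
  by rewrite /tail; case: he => he; subst e; split; nia.
move: (tail e n A B C) hE hE1 => E hE hE1.
by case: he hE1 hCB => he hE1 hCB; subst e; split; [split | | split | ]; nia.
Qed.

Ltac upd_simp := repeat match goal with |- context [upd ?x ?y ?z] =>
  first [rewrite (@updpp x y z ltac:(lia) ltac:(lia))
        | rewrite (@updnn x y z ltac:(lia) ltac:(lia))
        | rewrite (@updpn x y z ltac:(lia) ltac:(lia))
        | rewrite (@updnp x y z ltac:(lia) ltac:(lia))
        | rewrite (@updpp x y z ltac:(nia) ltac:(nia))
        | rewrite (@updnn x y z ltac:(nia) ltac:(nia))
        | rewrite (@updpn x y z ltac:(nia) ltac:(nia))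
        | rewrite (@updnp x y z ltac:(nia) ltac:(nia))] end.

(** * Mutations of preforks and of their squares and pentagons *)

Lemma reach_prefork1 t : prefork t -> reach t -> reach (mut 1 t).
Proof.
case: t => a b c d e f st ht; apply: (@reach_exit [:: Sw01]) => //.
by move: st => /= [? ? ? [? ?] [? ?]]; upd_simp; split; nia.
Qed.

Lemma reach_prefork2 t : prefork t -> reach t -> reach (mut 0 t) -> reach (mut 2 t).
Proof.
case: t => a b c d e f st ht h0.
case: (Z_le_gt_dec f (- 2)) => [f2|f2].
  apply: (@reach_exit [:: Sw01; Sw12; Sw01]) => //.
  by move: st => /= [? ? ? [? ?] [? ?]]; upd_simp; split; nia.
case: (Z_le_gt_dec 2 f) => [f2'|f2'].
  apply: (@reach_exit [:: Opp; Sw01; Sw12]) => //.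
  by move: st => /= [? ? ? [? ?] [? ?]]; upd_simp; split; nia.
by apply: reach_side => //=; lia.
Qed.

Lemma prefork_sw23 t : prefork t -> prefork (act Sw23 t).
Proof. by case: t => a b c d e f /= [? ? ? ? ?]; split. Qed.

Lemma reach_prefork3 t : prefork t -> reach t -> reach (mut 0 t) -> reach (mut 3 t).
Proof.
move=> st ht h0; rewrite -(actK Sw23 (mut 3 t)); apply: reach_act.
rewrite -[mut 3 t]/(mut (vact Sw23 2) t) -mut_act; apply: reach_prefork2.
- exact: prefork_sw23.
- exact: reach_act.
by rewrite mut_act; apply: reach_act.
Qed.

Lemma small_cases (f : Z) : - 1 <= f <= 1 -> [\/ f = - 1, f = 0 | f = 1].
Proof.
move=> hf; case: (Z.eq_dec f 0) => ?; first by constructor 2.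
by case: (Z.eq_dec f 1) => ?; [constructor 3 | constructor 1; lia].
Qed.

Lemma reach_side_exit t : prefork t -> - 1 <= b23 t <= 1 -> reach (mut 2 t) ->
  reach (mut 0 (mut 2 t)) /\ reach (mut 1 (mut 2 t)).
Proof.
move=> st ft ht; split.
- apply: (@reach_exit [:: Opp; Sw12]) => //.
  case: t st ft {ht} => a b c d e f /= [? ? ? [? ?] [? ?]] /small_cases[]->;
  (* The new entry at (0, 1) is quadratic; only this bound, a consequence of [d <= a] and [2 <= b],
     is kept. *)
  upd_simp; (have hT : - d <= a + b * - d by nia);
  move: (a + b * - d) hT => T hT; split; nia.
- apply: (@reach_exit [:: Sw12; Sw01]) => //.
  case: t st ft {ht} => a b c d e f /= [? ? ? [? ?] [? ?]] /small_cases[]->;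
  upd_simp; (have hT : - d <= a + b * - d by nia);
  move: (a + b * - d) hT => T hT; split; nia.
Qed.

(** After both mutations the entry at (0, 1) is again replaced by a variable with a lower bound. *)
Ltac bottom_exit w a b d e :=
  apply: (@reach_exit w) => //; rewrite /=; upd_simp;
  match goal with |- context [a + b * - d + ?r] =>
    assert (- d - e <= a + b * - d + r) by nia;
    generalize dependent (a + b * - d + r) end;
  intros; split; nia.

Lemma reach_bottom_exit t : prefork t -> - 1 <= b23 t <= 1 ->
  reach (mut 3 (mut 2 t)) ->
  reach (mut 0 (mut 3 (mut 2 t))) /\ reach (mut 1 (mut 3 (mut 2 t))).
Proof.
case: t => a b c d e f [? ? ? [? ?] [? ?]] /small_cases hf ht.
case: hf => hf; rewrite /= in hf; subst f; split.
- bottom_exit ([::] : seq gen) a b d e.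
- bottom_exit [:: Sw12; Sw23; Sw01] a b d e.
- bottom_exit ([::] : seq gen) a b d e.
- bottom_exit [:: Opp; Sw01] a b d e.
- bottom_exit [:: Opp; Sw12; Sw23] a b d e.
- bottom_exit [:: Opp; Sw01] a b d e.
Qed.

(** Type A2: five alternating mutations at 2 and 3 amount to exchanging these two vertices. *)
Lemma pentagon t : prefork t -> - 1 <= b23 t <= 1 -> b23 t <> 0 ->
  mut 2 (mut 3 (mut 2 t)) = mut 3 (mut 2 (act Sw23 t)).
Proof.
case: t => a b c d e f st hf f0.
case: (small_cases hf) f0 => {hf} /= hf f0; subst f => //;
move: st => /= [? ? ? [? ?] [? ?]]; upd_simp; congr Skew4; ring.
Qed.

(** Type A1 x A1: mutations at two vertices not joined by an arrow commute. *)
Lemma square t : prefork t -> b23 t = 0 -> mut 2 (mut 3 (mut 2 t)) = mut 3 t.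
Proof.
case: t => a b c d e f st /= hf; subst f.
move: st => /= [? ? ? [? ?] [? ?]]; upd_simp; congr Skew4; ring.
Qed.

Lemma reach_bottom2 t : prefork t -> - 1 <= b23 t <= 1 -> reach (mut 0 t) ->
  reach (mut 2 (mut 3 (mut 2 t))).
Proof.
move=> st ft h0; case: (Z.eq_dec (b23 t) 0) => f0.
  by rewrite square //; apply: reach_prefork3 => //; apply: reach_prefork.
rewrite pentagon //; apply: reach_bottom; first exact: prefork_sw23.
  by case: t ft {st h0 f0} => /= *; lia.
by rewrite mut_act; apply: reach_act.
Qed.

(** * Mutations along the chain of squares and pentagons *)

Lemma tail_bounds e n A B C : strip e n A B C ->
  A + 2 * B <= tail e n A B C /\ (e = 1 -> 2 * A + B <= tail e n A B C).
Proof.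
move/strip_bounds=> [[he hn hA hB hC] hCB].
by rewrite /tail; case: he => he; subst e; split; nia.
Qed.

Ltac strip_facts h :=
  have [[he hn hA hB hC] hCB] := strip_bounds h;
  have [hE hE1] := tail_bounds h.

Ltac strip_eq :=
  rewrite /nodeY /nodeZ /nodeX /nodeV /nodeW /nodeU /=; upd_simp;
  congr Skew4; rewrite /tail; ring.

Section Strip.

Variables e n A B C : Z.
Hypothesis h : strip e n A B C.
Let E := tail e n A B C.

Lemma mut1_Y : mut 1 (nodeY e n A B C) = nodeZ e n A B C.
Proof. by strip_facts h; case: he => ?; subst e; strip_eq. Qed.

Lemma mut2_Y : mut 2 (nodeY e n A B C) = nodeW e n A B C.
Proof. by strip_facts h; strip_eq. Qed.

Lemma mut2_Z : mut 2 (nodeZ e n A B C) = nodeX e n A B C.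
Proof. by strip_facts h; strip_eq. Qed.

Lemma mut1_X : mut 1 (nodeX e n A B C) = nodeV e n A B C.
Proof. by strip_facts h; case: he => ?; subst e; strip_eq. Qed.

Lemma mut0_X : mut 0 (nodeX e n A B C) = nodeY e n (n * E - A - B) (A + e * E) E.
Proof.
by strip_facts h; rewrite /E; case: he hE hE1 => ?; subst e;
  rewrite /nodeX /nodeY; move: (tail _ _ _ _ _) => F hE hE1; strip_eq.
Qed.

Lemma mut1_W : mut 1 (nodeW e n A B C) = act Sw12 (nodeV e n A B C).
Proof. by strip_facts h; strip_eq. Qed.

Lemma mut0_V0 : e = 0 ->
  mut 0 (nodeV e n A B C) = nodeZ e n (n * E - A - B) (A + e * E) E.
Proof.
by strip_facts h; rewrite /E => ?; subst e; rewrite /nodeV /nodeZ;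
  move: (tail _ _ _ _ _) hE hE1 => F hE hE1; strip_eq.
Qed.

Lemma mut0_V1 : e = 1 -> mut 0 (nodeV e n A B C) = nodeU n A B C.
Proof.
by strip_facts h; rewrite /E => ?; subst e; rewrite /nodeV /nodeU;
  move: (tail _ _ _ _ _) hE hE1 => F hE hE1; strip_eq.
Qed.

Lemma mut1_U : e = 1 -> mut 1 (nodeU n A B C) =
  act Sw01 (nodeZ e n (n * E - A - B) (A + e * E) E).
Proof.
by strip_facts h; rewrite /E => ?; subst e; rewrite /nodeZ /nodeU;
  move: (tail _ _ _ _ _) hE hE1 => F hE hE1; strip_eq.
Qed.

End Strip.

(** * Mutations leaving a strip for a prefork *)

(** The word [w] moves the mutated vertex to the point of return. The tail, and through [hyp] other
    products, become variables known only by lower bounds, to keep the degree low for [nia]. *)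
Ltac exit_strip w hyp :=
  move=> ?; apply: (@reach_exit w) => //;
  rewrite /nodeY /nodeZ /nodeX /nodeV /nodeW /nodeU /=;
  try match goal with
    hT : _ <= tail ?a ?b ?c ?d ?f, hT' : _ <= tail ?a ?b ?c ?d ?f |- _ =>
    revert hT hT'; generalize (tail a b c d f); intros ? ? ? end;
  upd_simp; hyp; split; nia.

Section Exits.

Variables e n A B C : Z.
Hypothesis h : strip e n A B C.

Lemma exit_W0 : reach (nodeW e n A B C) -> reach (mut 0 (nodeW e n A B C)).
Proof.
strip_facts h.
exit_strip [:: Opp; Sw12] ltac:(
  have hP : A <= n * A - C by nia; move: (n * A - C) hP => P hP).
Qed.

Lemma tail_ge : n + A + B - 1 <= tail e n A B C.
Proof. strip_facts h; rewrite /tail; case: he => ?; subst e; nia. Qed.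

Lemma exit_X3 : reach (nodeX e n A B C) -> reach (mut 3 (nodeX e n A B C)).
Proof.
have hn' := tail_ge; strip_facts h.
exit_strip [:: Sw01; Sw12; Sw23; Sw01; Sw12] ltac:(idtac).
Qed.

Lemma exit_U2 : e = 1 -> reach (nodeU n A B C) -> reach (mut 2 (nodeU n A B C)).
Proof.
have hn' := tail_ge; strip_facts h; move=> ?; subst e.
exit_strip [:: Opp; Sw01; Sw12] ltac:(idtac;
  match goal with |- context [(n + 1) * ?z - B] =>
    (have hQ : z + n <= (n + 1) * z - B by nia);
    move: ((n + 1) * z - B) hQ => Q hQ end).
Qed.

Lemma exit_U3 : e = 1 -> reach (nodeU n A B C) -> reach (mut 3 (nodeU n A B C)).
Proof.
have hn' := tail_ge; strip_facts h; move=> ?; subst e.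
exit_strip [:: Opp; Sw01; Sw12; Sw23; Sw01; Sw12] ltac:(idtac;
  match goal with |- context [(n + 1) * ?z - B] =>
    (have hQ : z + n <= (n + 1) * z - B by nia);
    move: ((n + 1) * z - B) hQ => Q hQ end).
Qed.

Hypothesis B2 : 2 <= B.
Hypothesis nA : n <= A.

Lemma exit_Y3 : reach (nodeY e n A B C) -> reach (mut 3 (nodeY e n A B C)).
Proof.
strip_facts h; case: he => ?; subst e;
exit_strip [:: Sw01; Sw12; Sw23] ltac:(idtac).
Qed.

Lemma exit_W3 : reach (nodeW e n A B C) -> reach (mut 3 (nodeW e n A B C)).
Proof.
strip_facts h; exit_strip [:: Sw01; Sw12; Sw23; Sw01; Sw12] ltac:(
  have hP : A <= n * A - C by nia; move: (n * A - C) hP => P hP).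
Qed.

Lemma exit_V3 : reach (nodeV e n A B C) -> reach (mut 3 (nodeV e n A B C)).
Proof.
have hn' := tail_ge; strip_facts h; case: he => ?; subst e;
exit_strip [:: Opp; Sw01; Sw12; Sw23] ltac:(idtac).
Qed.

(** The entry of Z at (0, 3) is [- C] if [e = 0] and [B - C], made at least 2 by the hypothesis, if
    [e = 1]; the two signs require different words. *)
Lemma exit_Z3 : (e = 1 -> C + 2 <= B) ->
  reach (nodeZ e n A B C) -> reach (mut 3 (nodeZ e n A B C)).
Proof.
move=> hZ; strip_facts h; case: he => ?; subst e.
  exit_strip [:: Opp; Sw01; Sw12; Sw23; Sw01; Sw12] ltac:(idtac).
have {}hZ := hZ erefl; exit_strip [:: Sw01; Sw12; Sw23; Sw01] ltac:(idtac).
Qed.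

End Exits.

(** * Search among finitely many explicit quivers *)

Definition skew4_eqb (t u : skew4) : bool :=
  let: Skew4 a b c d e f := t in let: Skew4 a' b' c' d' e' f' := u in
  [&& Z.eqb a a', Z.eqb b b', Z.eqb c c', Z.eqb d d', Z.eqb e e' & Z.eqb f f'].

Lemma skew4_eqbP t u : skew4_eqb t u -> t = u.
Proof.
case: t u => [? ? ? ? ? ?] [? ? ? ? ? ?] /=.
by do 5![case/andP=> /Z.eqb_spec->] => /Z.eqb_spec->.
Qed.

(** Normal forms of the 24 vertex permutations, each with and without reversal. *)
Definition words : seq (seq gen) :=
  let prod := allpairs cat in
  prod (prod [:: [::]; [:: Opp]] [:: [::]; [:: Sw01]])
       (prod [:: [::]; [:: Sw12]; [:: Sw12; Sw01]]
             [:: [::]; [:: Sw23]; [:: Sw23; Sw12]; [:: Sw23; Sw12; Sw01]]).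

Definition strip_nodes e n A B C : seq skew4 :=
  [:: nodeY e n A B C; nodeZ e n A B C; nodeX e n A B C; nodeV e n A B C;
      nodeW e n A B C].

(** Numerical targets for the mutations settled by computation instead of a general formula. *)
Definition known : seq skew4 :=
  sporadic ++ [:: nodeP 2; nodeQ 2] ++ strip_nodes 1 2 3 1 2 ++
  strip_nodes 0 5 2 1 2 ++ strip_nodes 0 5 7 1 2 ++ strip_nodes 0 2 7 1 5 ++
  strip_nodes 1 7 9 2 2 ++ strip_nodes 1 7 33 5 5 ++ strip_nodes 1 2 8 5 5 ++
  [seq (let: (n, A, B, C) := s in
        let E := tail 0 n A B C in nodeZ 0 n (n * E - A - B) (A + 0 * E) E)
     | s <- [:: (5, 2, 1, 2); (5, 7, 1, 2); (2, 7, 1, 5)]].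

Lemma known_reach t : List.In t known -> reach t.
Proof.
have strip_node e n A B C : strip e n A B C ->
    List.In t (strip_nodes e n A B C) -> reach t.
  move=> h; do 5?[case=> [<-|]] => //;
  [exact: reach_Y | exact: reach_Z | exact: reach_X | exact: reach_V
  | exact: reach_W].
rewrite /known.
case/(List.in_app_or sporadic) => [/reach_sporadic //|].
case/(List.in_app_or [:: nodeP 2; nodeQ 2]).
  by case=> [<-|[<-|//]]; [exact: reach_P | exact: reach_Q].
case/(List.in_app_or (strip_nodes _ _ _ _ _)) =>
  [/(strip_node _ _ _ _ _ (@strip_family 2 ltac:(lia)))//|].
case/(List.in_app_or (strip_nodes _ _ _ _ _)) =>
  [/(strip_node _ _ _ _ _ strip_start1)//|].
case/(List.in_app_or (strip_nodes _ _ _ _ _)) =>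
  [/(strip_node _ _ _ _ _ strip_start2)//|].
case/(List.in_app_or (strip_nodes _ _ _ _ _)) =>
  [/(strip_node _ _ _ _ _ strip_start3)//|].
case/(List.in_app_or (strip_nodes _ _ _ _ _)) =>
  [/(strip_node _ _ _ _ _ strip_start4)//|].
case/(List.in_app_or (strip_nodes _ _ _ _ _)) =>
  [/(strip_node _ _ _ _ _ strip_start5)//|].
case/(List.in_app_or (strip_nodes _ _ _ _ _)) =>
  [/(strip_node _ _ _ _ _ strip_start6)//|].
case=> [<-|]; first exact: reach_Z (strip_next strip_start1).
case=> [<-|]; first exact: reach_Z (strip_next strip_start2).
by case=> // <-; exact: reach_Z (strip_next strip_start3).
Qed.

Lemma reach_search t :
  List.existsb
    (fun u => List.existsb (fun w => skew4_eqb (actw w u) t) words) known ->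
  reach t.
Proof.
move=> /List.existsb_exists[u [/known_reach hu]] /List.existsb_exists[w [_]].
by move/skew4_eqbP; apply: reach_iso.
Qed.

Ltac search := by apply: reach_search; vm_compute.

Lemma sporadic_mut t k : List.In t sporadic -> reach (mut k t).
Proof.
by move=> /= ht; do 9?[case: ht => [<-|ht]] => //;
  case: k => [|[|[|k]]]; apply: reach_search; vm_compute.
Qed.

(** Together the two inequalities make the mutations at 3 of Y, W and V preforks. Both hold after
    every [strip_next]; the strips that fail are initial ones with [B = 1], listed in [strip_B1]. *)
Lemma strip_regular e n A B C : strip e n A B C -> 2 <= B -> n <= A.
Proof.
case=> {e n A B C} [n hn|n hn|||||||e n A B C h E] B2; try lia; try nia.
have [[_ ? ? ? ?] _] := strip_bounds h; have [hE _] := tail_bounds h.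
by move: hE; rewrite -/E => hE; clearbody E; nia.
Qed.

Lemma strip_B1 (P : Z -> Z -> Z -> Z -> Z -> Prop) e n A B C :
  strip e n A B C -> B < 2 ->
  (forall m, 2 <= m -> P 1 m (m + 1) 1 2) -> P 0 5 2 1 2 -> P 0 5 7 1 2 ->
  P 0 2 7 1 5 -> P e n A B C.
Proof.
case=> {e n A B C} [n hn|n hn|||||||e n A B C h E] B2; try lia; try by [].
  by move=> hP *; apply: hP.
have [[he ? ? ? ?] _] := strip_bounds h; have [hE _] := tail_bounds h.
by move: hE B2; rewrite -/E => hE; case: he => ->; lia.
Qed.

(** * Remaining mutations of the two sequences and of the strips *)

Ltac iso w hu := apply: (@reach_iso w _ _ hu);
  rewrite /nodeP /nodeQ /nodeY /nodeZ /nodeX /nodeV /nodeW /nodeU /tail /=;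
  upd_simp; congr Skew4; ring.

Lemma reach_P_mut1 n : 2 <= n -> reach (mut 1 (nodeP n)).
Proof.
move=> hn; apply: (@reach_exit [:: Sw01]); [exact: reach_P | by [] |].
by rewrite /=; upd_simp; split; lia.
Qed.

Lemma reach_P_mut n k : 2 <= n -> reach (mut k (nodeP n)).
Proof.
(* For [n = 2] the isomorphisms with parameter [n - 1] would leave the range of the sequences. *)
move=> hn; case: (Z.eq_dec n 2) => [->|n2].
  case: k => [|[|[|k]]]; [search | | search | search].
  exact: reach_P_mut1.
case: k => [|[|[|k]]].
- have hu := @strip_family (n - 1) ltac:(lia).
  iso [:: Opp; Sw01; Sw12; Sw23; Sw01; Sw12; Sw01] (reach_Z hu).
- exact: reach_P_mut1.
- iso [:: Opp; Sw12; Sw01] (reach_Z (strip_family hn)).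
- iso [:: Opp; Sw01; Sw12; Sw23; Sw01] (@reach_Q (n - 1) ltac:(lia)).
Qed.

Lemma reach_Q_mut n k : 2 <= n -> reach (mut k (nodeQ n)).
Proof.
move=> hn; case: k => [|[|[|k]]].
- iso [:: Sw01; Sw12; Sw23; Sw12; Sw01] (@reach_Q (n + 1) ltac:(lia)).
- apply: (@reach_exit [:: Sw01]); [exact: reach_Q|by []|].
  by rewrite /=; upd_simp; split; nia.
- iso [:: Opp; Sw23; Sw01; Sw12; Sw01] (@reach_P (n + 1) ltac:(lia)).
- case: (Z.eq_dec n 2) => [->|n2]; first search.
  iso [:: Sw01; Sw12; Sw23; Sw12; Sw01] (@reach_Q (n - 1) ltac:(lia)).
Qed.

Section StripMut.

Variables e n A B C : Z.
Hypothesis h : strip e n A B C.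

Lemma reach_Y3 : reach (mut 3 (nodeY e n A B C)).
Proof.
case: (Z_le_gt_dec 2 B) => B2.
  by apply: (exit_Y3 h B2 (strip_regular h B2)); apply: reach_Y.
apply: (@strip_B1 (fun e n A B C => reach (mut 3 (nodeY e n A B C)))
         _ _ _ _ _ h); [lia| |search|search|search] => m hm.
(* The mutation at 3 moves along the family, from [m] to [m + 1]. *)
iso [:: Sw01; Sw12; Sw23; Sw12; Sw01] (reach_Y (@strip_family (m + 1) ltac:(lia))).
Qed.

Lemma reach_W3 : reach (mut 3 (nodeW e n A B C)).
Proof.
case: (Z_le_gt_dec 2 B) => B2.
  by apply: (exit_W3 h B2 (strip_regular h B2)); apply: reach_W.
apply: (@strip_B1 (fun e n A B C => reach (mut 3 (nodeW e n A B C)))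
         _ _ _ _ _ h); [lia| |search|search|search] => m hm.
(* Here the mutation at 3 passes to the branch with the same [m]. *)
iso [:: Opp; Sw01; Sw12; Sw23; Sw01] (reach_W (strip_branch hm)).
Qed.

Lemma reach_V3 : reach (mut 3 (nodeV e n A B C)).
Proof.
case: (Z_le_gt_dec 2 B) => B2.
  by apply: (exit_V3 h B2 (strip_regular h B2)); apply: reach_V.
apply: (@strip_B1 (fun e n A B C => reach (mut 3 (nodeV e n A B C)))
         _ _ _ _ _ h); [lia| |search|search|search] => m hm.
iso [:: Opp; Sw01; Sw12; Sw23] (reach_X (strip_branch hm)).
Qed.

End StripMut.

Lemma reach_Y0 e n A B C : strip e n A B C ->
  reach (mut 0 (nodeY e n A B C)).
Proof.
case=> {e n A B C} [n hn|n hn|||||||e n A B C h E];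
  [| | search | search | search | search | search | search |].
- case: (Z.eq_dec n 2) => [->|n2]; first search.
  iso [:: Sw01; Sw12; Sw23; Sw12; Sw01] (reach_Y (@strip_family (n - 1) ltac:(lia))).
- iso [:: Opp; Sw23; Sw01; Sw12; Sw01] (reach_Y (strip_family hn)).
- by rewrite -(mut0_X h) mutK; apply: reach_X.
Qed.

Lemma reach_Z0 e n A B C : strip e n A B C ->
  reach (mut 0 (nodeZ e n A B C)).
Proof.
case=> {e n A B C} [n hn|n hn|||||||e n A B C h E];
  [| | search | search | search | search | search | search |].
- iso [:: Opp; Sw01; Sw12] (reach_P hn).
- iso [:: Opp; Sw23; Sw12; Sw01] (reach_X (strip_family hn)).
(* This Z is joined to V of the preceding strip parameters by a square if [e = 0], and to U by a
   pentagon if [e = 1]; that mutation is undone. *)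
- have [[he _ _ _ _] _] := strip_bounds h; case: he => he.
    by rewrite -(mut0_V0 h he) mutK; apply: reach_V.
  rewrite -[nodeZ _ _ _ _ _](actK Sw01) -(mut1_U h he) mut_act mutK.
  by apply: reach_act; apply: reach_U; rewrite -he.
Qed.

Lemma reach_Z3 e n A B C : strip e n A B C ->
  reach (mut 3 (nodeZ e n A B C)).
Proof.
case=> {e n A B C} [n hn|n hn|||||||e n A B C h E];
  [| | search | search | search | search | search | search |].
- iso [:: Opp; Sw01; Sw12; Sw23; Sw01; Sw12; Sw01] (@reach_P (n + 1) ltac:(lia)).
- iso [:: Opp; Sw23; Sw12; Sw01] (reach_U (strip_family hn)).
- have h' := strip_next h; rewrite -/E in h'.
  have [hE hE1] := tail_bounds h; have [[he hn hA hB hC] hCB] := strip_bounds h.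
  (* The new [B] is [A + e * E] and the new [C] is [E]; for [e = 1] they differ by [A], which is at
     least 2. *)
  have B2 : 2 <= A + e * E by rewrite /E; case: he => he; subst e; lia.
  apply: (exit_Z3 h' B2 (strip_regular h' B2)); last exact: reach_Z.
  by move=> he1; subst e; rewrite /E; lia.
Qed.

(** * Closure under mutation *)

Lemma reach_mut t k : reach t -> reach (mut k t).
Proof.
move=> ht; elim: ht k => {t}.
- by move=> g t _ IH k; rewrite mut_act; apply: reach_act.
- by move=> t ht k; apply: sporadic_mut.
- by move=> n hn k; apply: reach_P_mut.
- by move=> n hn k; apply: reach_Q_mut.
- move=> e n A B C h [|[|[|k]]].
  + exact: reach_Y0.
  + by rewrite (mut1_Y h); apply: reach_Z.
  + by rewrite (mut2_Y h); apply: reach_W.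
  + exact: reach_Y3.
- move=> e n A B C h [|[|[|k]]].
  + exact: reach_Z0.
  + by rewrite -(mut1_Y h) mutK; apply: reach_Y.
  + by rewrite (mut2_Z h); apply: reach_X.
  + exact: reach_Z3.
- move=> e n A B C h [|[|[|k]]].
  + by rewrite (mut0_X h); apply: reach_Y; apply: strip_next.
  + by rewrite (mut1_X h); apply: reach_V.
  + by rewrite -(mut2_Z h) mutK; apply: reach_Z.
  + by apply: (exit_X3 h); apply: reach_X.
- move=> e n A B C h [|[|[|k]]].
  + have [[[he|he] _ _ _ _] _] := strip_bounds h.
      by rewrite (mut0_V0 h he); apply: reach_Z; apply: strip_next.
    by rewrite (mut0_V1 h he); apply: reach_U; rewrite -he.
  + by rewrite -(mut1_X h) mutK; apply: reach_X.
  + rewrite -[nodeV _ _ _ _ _](actK Sw12) -(mut1_W h) mut_act mutK.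
    by apply: reach_act; apply: reach_W.
  + exact: reach_V3.
- move=> e n A B C h [|[|[|k]]].
  + by apply: (exit_W0 h); apply: reach_W.
  + by rewrite (mut1_W h); apply: reach_act; apply: reach_V.
  + by rewrite -(mut2_Y h) mutK; apply: reach_Y.
  + exact: reach_W3.
- move=> n A B C h [|[|[|k]]].
  + by rewrite -(mut0_V1 h erefl) mutK; apply: reach_V.
  + by rewrite (mut1_U h erefl); apply: reach_act; apply: reach_Z; apply: strip_next.
  + by apply: (exit_U2 h erefl); apply: reach_U.
  + by apply: (exit_U3 h erefl); apply: reach_U.
- move=> t st h0 _ [|[|[|k]]] //.
  + by apply: reach_prefork1 => //; apply: reach_prefork.
  + by apply: reach_prefork2 => //; apply: reach_prefork.
  + by apply: (reach_prefork3 st) => //; apply: reach_prefork.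
- move=> t st ft h0 _; have [? ?] := reach_side_exit st ft (reach_side st ft h0).
  move=> [|[|[|k]]] //.
    by rewrite mutK; apply: reach_prefork.
  exact: (reach_bottom st ft h0).
- move=> t st ft h0 _.
  have [? ?] := reach_bottom_exit st ft (reach_bottom st ft h0).
  move=> [|[|[|k]]] //.
    exact: reach_bottom2.
  by rewrite -[mut k.+3 _]/(mut 3 _) mutK; apply: reach_side.
Qed.

(** * Oriented triangles in all members of the set *)

Definition oriented (x y z : Z) : Prop :=
  0 < x /\ 0 < y /\ 0 < z \/ x < 0 /\ y < 0 /\ z < 0.

Definition cyclic4 (t : skew4) : Prop :=
  let: Skew4 a b c d e f := t in
  oriented a d (- b) \/ oriented a e (- c) \/ oriented b f (- c)
  \/ oriented d f (- e).

Lemma reach_cyclic t : reach t -> cyclic4 t.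
Proof.
have strip_cyclic e n A B C : strip e n A B C -> [/\ 2 <= n, 0 <= e,
    1 <= B <= A, 2 <= C <= A & B < tail e n A B C].
  by move=> h; have [[? ? ? ? ?] _] := strip_bounds h; have [? _] := tail_bounds h;
    split; lia.
rewrite /oriented; elim=> {t}.
- by move=> g [a b c d e f] _; case: g; rewrite /= /oriented; lia.
- by move=> t /= ht; do 9?[case: ht => [<-|ht]] => //; rewrite /= /oriented; lia.
- by move=> n hn; rewrite /= /oriented; lia.
- by move=> n hn; rewrite /= /oriented; lia.
- by move=> e n A B C /strip_cyclic[*]; rewrite /= /oriented; lia.
- by move=> e n A B C /strip_cyclic[*]; rewrite /= /oriented; lia.
- by move=> e n A B C /strip_cyclic[*]; rewrite /= /oriented; lia.
- by move=> e n A B C /strip_cyclic[*]; rewrite /= /oriented; lia.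
- by move=> e n A B C /strip_cyclic[*]; rewrite /= /oriented; nia.
- move=> n A B C /strip_cyclic[? _ ? _ hE]; rewrite /= /oriented.
  by right; right; left; left; nia.
- by move=> [a b c d e f] /= [? ? ? [? ?] _] *; rewrite /oriented; lia.
- move=> [a b c d e f] st ft _ _; have /small_cases := ft.
  (* The triangle 0, 1, 2 of a prefork is oriented, and the mutation at 2 reverses it. *)
  move: st => /= [? ? ? [? ?] [? ?]] [] ->; upd_simp; left; left; nia.
- move=> [a b c d e f] st ft _ _; have /small_cases := ft.
  move: st => /= [? ? ? [? ?] [? ?]] [] ->; upd_simp; right; left; left; nia.
Qed.

(** * Passage from quivers to their six matrix entries *)

Local Open Scope nat_scope.

Definition v0 : 'I_4 := @Ordinal 4 0 isT.
Definition v1 : 'I_4 := @Ordinal 4 1 isT.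
Definition v2 : 'I_4 := @Ordinal 4 2 isT.
Definition v3 : 'I_4 := @Ordinal 4 3 isT.

Lemma ord4P (k : 'I_4) : [\/ k = v0, k = v1, k = v2 | k = v3].
Proof.
case: k => [[|[|[|[|k]]]] hk] //;
  [constructor 1 | constructor 2 | constructor 3 | constructor 4]; exact: val_inj.
Qed.

Local Open Scope Z_scope.

Definition arr n (Q : quiver n) (i j : 'I_n) : Z :=
  Z.of_nat (Q i j) - Z.of_nat (Q j i).

Lemma arrN n (Q : quiver n) i j : arr Q j i = - arr Q i j.
Proof. by rewrite /arr; lia. Qed.

(** Without 2-cycles the arrow counts are recovered from their differences. *)
Lemma pos_arr n (Q : quiver n) i j : pos (arr Q i j) = Z.of_nat (Q i j).
Proof.
by rewrite /arr; case: (no_2cycle Q i j) => ->; [rewrite pos0 | rewrite posE]; lia.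
Qed.

Lemma delete_2cycles_diff n (M : 'M[nat]_n) i j :
  Z.of_nat (delete_2cycles M i j) - Z.of_nat (delete_2cycles M j i) =
  Z.of_nat (M i j) - Z.of_nat (M j i).
Proof.
rewrite !mxE (minnC (M j i)) /minn.
by case: ltnP => [/ltP|/leP] h; rewrite subnn -minusE; lia.
Qed.

Lemma arr_mutate n (Q : quiver n) k i j : i != k -> j != k ->
  arr (mutate Q k) i j = upd (arr Q i k) (arr Q k j) (arr Q i j).
Proof.
move=> ik jk; rewrite /arr delete_2cycles_diff !mxE.
rewrite (negPf ik) (negPf jk) /= /upd -!arrN !pos_arr /arr.
by rewrite -plusE -multE; lia.
Qed.

Lemma arr_mutate_at n (Q : quiver n) k i j : (i == k) || (j == k) ->
  arr (mutate Q k) i j = - arr Q i j.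
Proof.
move=> h; rewrite /arr delete_2cycles_diff !mxE (orbC (j == k)) h.
by case/orP: h => /eqP->; rewrite no_loop ?muln0 ?mul0n !addn0; lia.
Qed.

Definition skew4_of (Q : quiver 4) : skew4 :=
  Skew4 (arr Q v0 v1) (arr Q v0 v2) (arr Q v0 v3)
        (arr Q v1 v2) (arr Q v1 v3) (arr Q v2 v3).

Lemma skew4_of_mutate Q k : skew4_of (mutate Q k) = mut k (skew4_of Q).
Proof.
by case: (ord4P k) => ->; rewrite /skew4_of /= -!arrN;
  congr Skew4;
  first [by rewrite arr_mutate_at // -arrN | by rewrite arr_mutate].
Qed.

Lemma reach_mutations Q ks :
  reach (skew4_of Q) -> reach (skew4_of (foldl (@mutate 4) Q ks)).
Proof.
elim: ks Q => //= k ks IH Q hQ; apply: IH.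
by rewrite skew4_of_mutate; apply: reach_mut.
Qed.

Lemma reach_vortex : reach (skew4_of vortex).
Proof.
by apply: reach_sporadic; left; rewrite /skew4_of /arr !mxE.
Qed.

(** Closed directed walks, through [acyclicP], spare the construction of an induced cycle
    labelling. *)
Lemma oriented_cycle (Q : quiver 4) i j k :
  oriented (arr Q i j) (arr Q j k) (arr Q k i) -> ~ acyclic Q.
Proof.
have arr_gt0 x y : 0 < arr Q x y -> (0 < Q x y)%N.
  by rewrite /arr => h; apply/ltP; lia.
move=> h /acyclicP acQ; case: h => -[hij [hjk hki]].
  by have /negP := acQ [:: i; j; k] isT; apply; rewrite /= !arr_gt0.
have /negP := acQ [:: i; k; j] isT; apply.
by rewrite /= !arr_gt0 // arrN; lia.
Qed.

Lemma cyclic4_not_acyclic Q : cyclic4 (skew4_of Q) -> ~ acyclic Q.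
Proof.
by rewrite /= -!arrN => -[|[|[|]]]; apply: oriented_cycle.
Qed.

Lemma vortex_not_mutation_acyclic : ~ mutation_acyclic vortex.
Proof.
move=> [ks]; apply: cyclic4_not_acyclic; apply: reach_cyclic.
exact/reach_mutations/reach_vortex.
Qed.

(* Parity of the positive edges in the triangles of the vortex *)
Close Scope Z_scope.
Local Open Scope ring_scope.

Lemma adjacent_vortex x y : adjacent vortex x y = (x != y).
Proof. by case: (ord4P x) => ->; case: (ord4P y) => ->; rewrite /adjacent !mxE. Qed.

Definition tri (i j k : 'I_4) : {set 'I_4} := [set i; j; k].

Lemma tri_labelling i j k : uniq [:: i; j; k] ->
  cycle_labelling vortex (tri i j k) (fun a : 'I_3 => nth i [:: i; j; k] a).
Proof.
move=> u; split=> //.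
- by move=> a b /eqP; rewrite nth_uniq // => /eqP/val_inj.
- apply/setP=> x; rewrite /tri !inE; apply/imsetP/idP.
    by case=> -[[|[|[|a]]] ha] _ -> //=; rewrite eqxx ?orbT.
  case/orP=> [/orP[]|] /eqP->;
  [by exists (@Ordinal 3 0 isT) | by exists (@Ordinal 3 1 isT)
  | by exists (@Ordinal 3 2 isT)].
(* Any two distinct elements of Z/3Z are consecutive, as any two distinct vertices are adjacent. *)
- move=> a b; rewrite adjacent_vortex nth_uniq //.
  by case: a b => [[|[|[|a]]] ha] [[|[|[|b]]] hb].
Qed.

(** The increasing order matches the storage of an edge by its smaller end first. *)
Lemma positive_edges_tri A (i j k : 'I_4) : (i < j < k)%N ->
  odd #|positive_edges vortex A (tri i j k)| =
    (0 < A i j) (+) (0 < A i k) (+) (0 < A j k).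
Proof.
move=> ijk; pose s := [:: (i, j); (i, k); (j, k)].
have [us sE] : uniq s /\ forall x y : 'I_4, ((x, y) \in s) =
    [&& x \in tri i j k, y \in tri i j k, x < y & x != y]%N.
  move: ijk; rewrite {}/s.
  case: (ord4P i) => ->; case: (ord4P j) => ->; case: (ord4P k) => -> // _;
    split=> // x y; rewrite /tri !inE !xpair_eqE;
    by case: (ord4P x) => ->; case: (ord4P y) => ->.
have -> : positive_edges vortex A (tri i j k) =
    [set e in [seq e <- s | 0 < A e.1 e.2]].
  apply/setP=> -[x y]; rewrite [LHS]in_set [RHS]in_set mem_filter sE adjacent_vortex /=.
  by case: (0 < A x y); rewrite ?andbT ?andbF.
rewrite cardsE (card_uniqP _) ?filter_uniq // size_filter /=.
by case: (0 < A i j); case: (0 < A i k); case: (0 < A j k).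
Qed.

Lemma v0_not_oriented (Z : {set 'I_4}) :
  v0 \in Z -> ~ is_oriented_cycle vortex Z.
Proof.
move=> Z0 [k [c [[_ _ cZ _] oc]]]; move: Z0; rewrite -cZ => /imsetP[a _ a0].
(* The vertex [v0] is a source, so its predecessor on the cycle has no arrow to it. *)
have := oc (ord_pred a); rewrite ord_predK -a0 !mxE.
by case: (ord4P (c (ord_pred a))) => ->.
Qed.

Lemma oriented_tri : is_oriented_cycle vortex (tri v1 v3 v2).
Proof.
exists 3%N, (fun a => nth v1 [:: v1; v3; v2] a); split; first exact: tri_labelling.
by case=> [[|[|[|a]]] ha]; rewrite // mxE.
Qed.

Lemma vortex_no_admissible A : ~ admissible vortex A.
Proof.
move=> adm.
have cyc i j k : uniq [:: i; j; k] -> is_cycle vortex (tri i j k).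
  by move=> u; exists 3%N, (fun a => nth i [:: i; j; k] a); apply: tri_labelling.
have even (j k : 'I_4) : (0 < j < k)%N -> ~~ odd #|positive_edges vortex A (tri v0 j k)|.
  move=> jk; apply: (proj2 (adm _ (cyc v0 j k _))).
    by case: (ord4P j) jk => ->; case: (ord4P k) => ->.
  by apply: v0_not_oriented; rewrite /tri !inE eqxx.
have := proj1 (adm _ (cyc v1 v3 v2 isT)) oriented_tri.
(* The labelling follows the orientation, whereas the parity formula needs increasing vertices. *)
have -> : tri v1 v3 v2 = tri v1 v2 v3 by rewrite /tri setUAC.
move: (even v1 v2 isT) (even v1 v3 isT) (even v2 v3 isT).
rewrite !positive_edges_tri //.
by do 6![case: (0 < A _ _)].
Qed.

Theorem theorem4p11 :
  (~ exists A : 'M[int]_4,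
       quasi_cartan_companion vortex A /\ admissible vortex A) /\
  ~ mutation_acyclic vortex.
Proof.
split; last exact: vortex_not_mutation_acyclic.
by move=> [A [_ /vortex_no_admissible]].
Qed.
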